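(* Consider the following two-location circuit (the swap-resilient leakage-detection unit) acting on a data location $D$ and an ancilla location $A$ holding a qubit prepared in $|0\rangle$: apply, in order, (1) $X$ on $D$; (2) $\mathrm{CNOT}$ with control $D$ and target $A$; (3) $X$ on $D$ and $X$ on $A$; (4) $\mathrm{CNOT}$ with control $D$ and target $A$; (5) augmented readout of location $A$. The data qubit is accepted if the readout is the computational outcome $0$, and is flagged if the readout is $1$, 'lost', or 'leaked'. In the absence of additional faults within the circuit, under the swap-loss rules, the circuit preserves and accepts every computational input state of $D$, and it flags every leaked or lost input of $D$, for all possible loss-swap patterns.
   Context: Each location contains either a qubit in the computational subspace, a leaked qubit, or nothing (the qubit is lost). Swap-loss rules: a single- or two-qubit gate involving a leaked qubit is replaced by the identity. A single-qubit gate at a lost location is replaced by the identity. A two-qubit gate acting on two locations exactly one of which is lost is replaced by the identity, and then either the contents of the two locations (including their loss/leakage statuses and quantum states) are exchanged (a 'loss swap') or they are left unchanged; each such gate independently may or may not cause a swap, and a loss-swap pattern is a choice of swap/no swap for each such gate. Augmented readout of a location measures it in the computational basis and perfectly distinguishes computational outcomes $0$, $1$, leaked, and lost. 'Additional faults' means any gate noise, or new loss or leakage events occurring during the circuit. 'Preserves' means that the output state at $D$ equals the input state $\alpha|0\rangle+\beta|1\rangle$. *)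

(* Defs.v *)
From HB Require Import structures.
From mathcomp Require Import all_boot all_order all_algebra.
From mathcomp Require Import reals complex.

Set Implicit Arguments.
Unset Strict Implicit.
Unset Printing Implicit Defensive.

Import Order.TTheory GRing.Theory Num.Theory.
Local Open Scope ring_scope.

(* Basis contents of one location.  [Comp b] is the computational ket |b>.
   The leaked subspace is spanned by an arbitrary finite family [L] of
   non-computational levels; [Lost] means that the location holds nothing. *)
Inductive level (L : Type) : Type :=
| Comp of bool
| Leaked of L
| Lost.
Arguments Comp {L} _.
Arguments Lost {L}.

Section LevelFinType.
Variable L : finType.

Definition level_code (x : level L) : bool + option L :=
  match x with
  | Comp b => inl b
  | Leaked l => inr (Some l)
  | Lost => inr None
  end.

Definition level_decode (y : bool + option L) : level L :=
  match y with
  | inl b => Comp b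
  | inr (Some l) => Leaked l
  | inr None => Lost
  end.

Lemma level_codeK : cancel level_code level_decode.
Proof. by case. Qed.

HB.instance Definition _ := Finite.copy (level L) (can_type level_codeK).
End LevelFinType.

Inductive outcome := Read0 | Read1 | ReadLeaked | ReadLost.

Definition outcome_code (o : outcome) : bool * bool :=
  match o with
  | Read0 => (false, false)
  | Read1 => (false, true)
  | ReadLeaked => (true, false)
  | ReadLost => (true, true)
  end.

Definition outcome_decode (p : bool * bool) : outcome :=
  match p with
  | (false, false) => Read0
  | (false, true) => Read1
  | (true, false) => ReadLeaked
  | (true, true) => ReadLost
  end.

Lemma outcome_codeK : cancel outcome_code outcome_decode.
Proof. by case. Qed.

HB.instance Definition _ := Finite.copy outcome (can_type outcome_codeK).

(* Pure states with orthonormal basis [T], given by their amplitudes. *)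
Definition state (C : numClosedFieldType) (T : finType) := {ffun T -> C}.

Section States.
Variable C : numClosedFieldType.

Definition sqnorm (T : finType) (psi : state C T) : C :=
  \sum_t `|psi t| ^+ 2.

Definition unit_state (T : finType) (psi : state C T) : Prop :=
  sqnorm psi = 1.

Definition ket (T : finType) (t0 : T) : state C T :=
  [ffun t => (t == t0)%:R].

Definition tensor (T U : finType) (phi : state C T) (chi : state C U) :
    state C (T * U)%type :=
  [ffun x => phi x.1 * chi x.2].

(* The linear extension of the map |t> |-> |f t> on basis kets. *)
Definition extend (T : finType) (f : T -> T) (psi : state C T) : state C T :=
  [ffun u => \sum_(t | f t == u) psi t].

Definition supported (T : finType) (P : pred T) (psi : state C T) : Prop :=
  forall t, psi t != 0 -> P t.
End States.

Section Circuits.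
Variables (C : numClosedFieldType) (L : finType).

Definition is_leaked (x : level L) : bool :=
  if x is Leaked _ then true else false.

Definition is_lost (x : level L) : bool :=
  if x is Lost then true else false.

(* The first component is the data location D, the second the ancilla A. *)
Definition config : finType := (level L * level L)%type.

Definition x_level (x : level L) : level L :=
  if x is Comp b then Comp (~~ b) else x.

(* [swap] is only consulted when exactly one of the locations is lost. *)
Definition cnot_config (swap : bool) (x : config) : config :=
  match x with
  | (Comp b, Comp b') => (Comp b, Comp (b (+) b'))
  | (d, a) => if (is_lost d (+) is_lost a) && swap then (a, d) else (d, a)
  end.

Inductive gate := X_D | X_A | CNOT_DA.

Definition gate_config (g : gate) (swap : bool) (x : config) : config :=
  match g with
  | X_D => (x_level x.1, x.2)
  | X_A => (x.1, x_level x.2)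
  | CNOT_DA => cnot_config swap x
  end.

(* A loss-swap pattern [s] gives the swap choice [s k] of the [k]-th
   two-qubit gate of the circuit. *)
Fixpoint run (s : nat -> bool) (gs : seq gate) (psi : state C config) :
    state C config :=
  match gs with
  | [::] => psi
  | CNOT_DA :: gs' =>
      run (fun k => s k.+1) gs' (extend (gate_config CNOT_DA (s 0%N)) psi)
  | g :: gs' => run s gs' (extend (gate_config g false) psi)
  end.

Definition readout (x : level L) : outcome :=
  match x with
  | Comp false => Read0
  | Comp true => Read1
  | Leaked _ => ReadLeaked
  | Lost => ReadLost
  end.

(* Projective (Born rule) readout of location A. *)
Definition project_A (o : outcome) (psi : state C config) : state C config :=
  [ffun x : config => if readout x.2 == o then psi x else 0].

Definition prob_A (o : outcome) (psi : state C config) : C :=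
  sqnorm (project_A o psi).

Definition post_A (o : outcome) (psi : state C config) : state C config :=
  [ffun x => project_A o psi x / sqrtC (prob_A o psi)].

Definition state_at_D (psi : state C config) (phi : state C (level L)) : Prop :=
  exists2 chi : state C (level L), unit_state chi & psi = tensor phi chi.

(* The unitary part of the leakage-detection unit; the readout of A follows. *)
Definition ldu : seq gate := [:: X_D; CNOT_DA; X_D; X_A; CNOT_DA].

Definition ldu_out (s : nat -> bool) (phi : state C (level L)) :
    state C config :=
  run s ldu (tensor phi (ket C (Comp false))).

Definition accepted (o : outcome) : bool := o == Read0.

Definition flagged (o : outcome) : bool :=
  o \in [:: Read1; ReadLost; ReadLeaked].

Definition accepts (s : nat -> bool) (phi : state C (level L)) : Prop :=
  \sum_(o | accepted o) prob_A o (ldu_out s phi) = 1.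

Definition flags (s : nat -> bool) (phi : state C (level L)) : Prop :=
  \sum_(o | flagged o) prob_A o (ldu_out s phi) = 1.

Definition preserves (s : nat -> bool) (phi : state C (level L)) : Prop :=
  forall o, prob_A o (ldu_out s phi) != 0 ->
    state_at_D (post_A o (ldu_out s phi)) phi.

(* alpha |0> + beta |1> *)
Definition comp_state (alpha beta : C) : state C (level L) :=
  [ffun x => alpha * ket C (Comp false) x + beta * ket C (Comp true) x].
End Circuits.

(* Main.v *)
(** Every gate acts on basis kets by an involution, so the whole circuit acts by
    a permutation [F] of the basis configurations and preserves the norm.
    Without additional faults [F] fixes [(b, 0)] for [b] a bit, sends [(l, 0)]
    to [(l, 1)] for [l] leaked, and sends [(lost, 0)] to [(lost, 1)] or
    [(1, lost)] according to whether the number of loss swaps is even or odd. *)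
Require Import Defs.
From mathcomp Require Import all_boot all_order all_algebra.
From mathcomp Require Import reals complex.

Set Implicit Arguments.
Unset Strict Implicit.
Unset Printing Implicit Defensive.

Import Order.TTheory GRing.Theory Num.Theory.
Local Open Scope ring_scope.

Section Extend.
Variables (C : numClosedFieldType) (T : finType).
Implicit Types (f g : T -> T) (psi : state C T).

Lemma extend_comp f g psi : extend g (extend f psi) = extend (g \o f) psi.
Proof.
(* The preimages of [u] under [g \o f] are grouped by the intermediate value [f t]. *)
apply/ffunP => u; rewrite !ffunE [RHS](partition_big f (fun t => g t == u)) //=.
apply: eq_bigr => t /eqP gt_u; rewrite ffunE; apply: eq_bigl => v /=.
by case: eqP => [->|]; rewrite ?gt_u ?eqxx ?andbF.
Qed.

(** Only kets that carry amplitude have to be fixed: a preimage of [u] other than [u] is not a fixed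
    point, so it contributes zero, and if [u] itself is moved then [psi u] is already zero. *)
Lemma extend_fixed f psi :
  supported (fun t => f t == t) psi -> extend f psi = psi.
Proof.
move=> fix_f; apply/ffunP => u; rewrite ffunE big_mkcond (bigD1 u) //=.
rewrite big1 => [|t tNu]; first last.
  case: eqP => // ft_u; apply/eqP/negPn/negP => /fix_f.
  by rewrite ft_u eq_sym (negPf tNu).
rewrite addr0; case: ifPn => // fuNu; apply/esym/eqP/negPn/negP => /fix_f.
by apply/negP.
Qed.

Lemma supported_extend (P : pred T) f psi :
  supported (fun t => P (f t)) psi -> supported P (extend f psi).
Proof.
move=> suppP u; apply: contraR => PNu; rewrite ffunE big1 // => t /eqP ft_u.
by apply/eqP/negPn/negP => /suppP; rewrite ft_u (negPf PNu).
Qed.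

(** An injective self-map of a finite type is a permutation, so amplitudes are merely relabelled. *)
Lemma sqnorm_extend f psi : injective f -> sqnorm (extend f psi) = sqnorm psi.
Proof.
move=> f_inj; rewrite /sqnorm (reindex f) /=; last exact/onW_bij/injF_bij.
apply: eq_bigr => t _; rewrite ffunE (eq_bigl (pred1 t)) ?big_pred1_eq //.
by move=> v; rewrite /= (inj_eq f_inj).
Qed.

End Extend.

Section Tensor.
Variable C : numClosedFieldType.

Lemma sqnorm_tensor (T U : finType) (phi : state C T) (chi : state C U) :
  sqnorm (tensor phi chi) = sqnorm phi * sqnorm chi.
Proof.
rewrite /sqnorm big_distrlr /= pair_big /=; apply: eq_bigr => -[t u] _.
by rewrite ffunE /= normrM exprMn.
Qed.

Lemma unit_ket (T : finType) (t0 : T) : unit_state (ket C t0).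
Proof.
rewrite /unit_state /sqnorm (bigD1 t0) //= big1 ?ffunE ?eqxx.
  by rewrite normr1 expr1n addr0.
by move=> t tNt0; rewrite ffunE (negPf tNt0) normr0 expr0n.
Qed.

Lemma supported_tensor_ket (T U : finType) (P : pred T) (Q : pred (T * U))
    (phi : state C T) (u0 : U) :
  supported P phi -> (forall t, P t -> Q (t, u0)) ->
  supported Q (tensor phi (ket C u0)).
Proof.
move=> suppP PQ [t u]; rewrite !ffunE /= mulf_eq0 negb_or.
case/andP => /suppP Pt; have [->|_] := eqVneq u u0; last by rewrite eqxx.
by move=> _; apply: PQ.
Qed.

End Tensor.

Section Readout.
Variables (C : numClosedFieldType) (L : finType).
Implicit Types (psi : state C (config L)) (o : outcome).

(** After exchanging the sums, each ket of nonzero amplitude counts for exactly one outcome, its own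
    readout, which lies in [P]. *)
Lemma sum_prob_A (P : pred outcome) psi :
  supported (fun x => P (readout x.2)) psi ->
  \sum_(o | P o) prob_A o psi = sqnorm psi.
Proof.
move=> suppP; rewrite exchange_big /=; apply: eq_bigr => x _.
have [psix0|/suppP Px] := eqVneq (psi x) 0.
  rewrite psix0 big1 => [|o _]; first by rewrite normr0 expr0n.
  by rewrite ffunE psix0 if_same normr0 expr0n.
rewrite (bigD1 (readout x.2)) //= big1 ?ffunE ?eqxx ?addr0 //.
by move=> o /andP[_ oN]; rewrite ffunE eq_sym (negPf oN) normr0 expr0n.
Qed.

Lemma project_A_id o psi :
  supported (fun x => readout x.2 == o) psi -> project_A o psi = psi.
Proof.
move=> suppo; apply/ffunP => x; rewrite ffunE; case: ifPn => // xNo.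
by apply/esym/eqP/negPn/negP => /suppo; apply/negP.
Qed.

Lemma prob_A_eq0 o o' psi :
  supported (fun x => readout x.2 == o) psi -> o' != o -> prob_A o' psi = 0.
Proof.
move=> suppo o'No; rewrite /prob_A /sqnorm big1 // => x _; rewrite ffunE.
case: eqP => [xo'|_]; last by rewrite normr0 expr0n.
have [->|/suppo] := eqVneq (psi x) 0; first by rewrite normr0 expr0n.
by rewrite xo' (negPf o'No).
Qed.

End Readout.

Section Run.
Variables (C : numClosedFieldType) (L : finType).

(** The trajectory of a single basis configuration, consuming swap choices in the same order as
    [run]; for [ldu] it is the permutation [F]. *)
Fixpoint run_config (s : nat -> bool) (gs : seq gate) (x : config L) :
    config L :=
  match gs with
  | [::] => x
  | CNOT_DA :: gs' =>
      run_config (fun k => s k.+1) gs' (gate_config CNOT_DA (s 0%N) x)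
  | g :: gs' => run_config s gs' (gate_config g false x)
  end.

Lemma run_extend s gs (psi : state C (config L)) :
  run s gs psi = extend (run_config s gs) psi.
Proof.
elim: gs s psi => [|[] gs IHgs] s psi /=; rewrite ?IHgs ?extend_comp //.
(* Only the empty circuit remains, where the map being extended is the identity. *)
by rewrite extend_fixed // => t _; apply: eqxx.
Qed.

(** A loss swap leaves exactly one location lost, so the same choice swaps the contents back; on two
    bits, adding the control twice cancels. *)
Lemma gate_configK g swap : involutive (@gate_config L g swap).
Proof.
case: g; case: swap => -[[[]|l|] [[]|l'|]] //.
Qed.

Lemma run_config_inj s gs : injective (run_config s gs).
Proof.
elim: gs s => [|g gs IHgs] s; first exact.
case: g => x y /IHgs.
- exact: inv_inj (gate_configK X_D false) _ _.
- exact: inv_inj (gate_configK X_A false) _ _.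
- exact: inv_inj (gate_configK CNOT_DA (s 0%N)) _ _.
Qed.

Lemma sqnorm_ldu_out s (phi : state C (level L)) :
  sqnorm (ldu_out s phi) = sqnorm phi.
Proof.
rewrite /ldu_out run_extend (sqnorm_extend _ (@run_config_inj _ _)).
by rewrite sqnorm_tensor unit_ket mulr1.
Qed.

Lemma supported_ldu_out s (P : pred (level L)) (Q : pred (config L))
    (phi : state C (level L)) :
  supported P phi -> (forall d, P d -> Q (run_config s ldu (d, Comp false))) ->
  supported Q (ldu_out s phi).
Proof.
move=> suppP PQ; rewrite /ldu_out run_extend; apply: supported_extend.
exact: supported_tensor_ket suppP PQ.
Qed.

(** This reduces flagging of arbitrary superpositions to a check on each basis level in [P]. *)
Lemma flags_supported s (P : pred (level L)) (phi : state C (level L)) :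
    unit_state phi -> supported P phi ->
    (forall d, P d -> flagged (readout (run_config s ldu (d, Comp false)).2)) ->
  flags s phi.
Proof.
move=> phi1 suppP P_flagged.
rewrite /flags sum_prob_A ?sqnorm_ldu_out //.
exact: supported_ldu_out suppP P_flagged.
Qed.

Lemma sqnorm_comp_state (alpha beta : C) :
  sqnorm (comp_state L alpha beta) = `|alpha| ^+ 2 + `|beta| ^+ 2.
Proof.
rewrite /sqnorm (bigD1 (Comp false)) //= (bigD1 (Comp true)) //= big1.
  by rewrite !ffunE /= !(mulr0, mulr1) !(addr0, add0r).
move=> x /andP[xN0 xN1].
by rewrite !ffunE (negPf xN0) (negPf xN1) !mulr0 addr0 normr0 expr0n.
Qed.

Definition is_comp (x : level L) : bool :=
  if x is Comp _ then true else false.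

Lemma supported_comp_state (alpha beta : C) :
  supported is_comp (comp_state L alpha beta).
Proof. by case=> [b|l|] //; rewrite !ffunE /= !mulr0 addr0 eqxx. Qed.

(** For a data bit [b], the first CNOT writes [~~ b] on the ancilla, the middle X gates restore [b]
    on D and turn the ancilla into [b], and the second CNOT clears it. Nothing is lost, so no swap
    choice is consulted. *)
Lemma ldu_out_comp s (phi : state C (level L)) :
  supported is_comp phi -> ldu_out s phi = tensor phi (ket C (Comp false)).
Proof.
move=> supp_comp; rewrite /ldu_out run_extend; apply: extend_fixed.
by apply: supported_tensor_ket supp_comp _ => -[[]|l|].
Qed.

Lemma supported_Read0_ldu_out s (phi : state C (level L)) :
  supported is_comp phi ->
  supported (fun x => readout x.2 == Read0) (ldu_out s phi).
Proof. by move/supported_ldu_out; apply=> -[[]|l|]. Qed.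

Lemma accepts_comp s (phi : state C (level L)) :
  unit_state phi -> supported is_comp phi -> accepts s phi.
Proof.
move=> phi1 supp_comp; rewrite /accepts sum_prob_A ?sqnorm_ldu_out //.
exact: supported_Read0_ldu_out.
Qed.

Lemma preserves_comp s (phi : state C (level L)) :
  unit_state phi -> supported is_comp phi -> preserves s phi.
Proof.
move=> phi1 supp_comp o.
have supp0 := supported_Read0_ldu_out (s := s) supp_comp.
have [->|oN0] := eqVneq o Read0; last by rewrite (prob_A_eq0 supp0) ?eqxx.
(* The ancilla ends in |0>, so the projection acts trivially and the normalisation divides by 1. *)
move=> _; exists (ket C (Comp false)); first exact: unit_ket.
rewrite /post_A /prob_A project_A_id // sqnorm_ldu_out phi1 sqrtC1.
by rewrite ldu_out_comp //; apply/ffunP => x; rewrite ffunE divr1.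
Qed.

End Run.

Theorem proposition1 (R : realType) (L : finType) (s : nat -> bool) :
  [/\ forall alpha beta : R[i], `|alpha| ^+ 2 + `|beta| ^+ 2 = 1 ->
        preserves s (comp_state L alpha beta) /\
        accepts s (comp_state L alpha beta),
      forall phi : state R[i] (level L),
        unit_state phi -> supported (@is_leaked L) phi -> flags s phi
    & forall phi : state R[i] (level L),
        unit_state phi -> supported (@is_lost L) phi -> flags s phi].
Proof.
split=> [alpha beta ab1|phi phi1 leaked|phi phi1 lost].
- have unit_ab : unit_state (comp_state L alpha beta).
    by rewrite /unit_state sqnorm_comp_state.
  have supp_ab := supported_comp_state (alpha := alpha) (beta := beta).
  by split; [apply: preserves_comp | apply: accepts_comp].
(* Both CNOTs act trivially, so X on A alone turns the ancilla into 1. *)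
- by apply: flags_supported phi1 leaked _ => -[].
- apply: flags_supported phi1 lost _ => -[] // _ /=.
  (* Step (3) applies X to both locations, so the ancilla qubit is flipped to 1 wherever the first
     CNOT left it; A then reads 1 or lost in all four swap patterns. *)
  by case: (s 0%N); case: (s 1%N).
Qed.
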